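(* Let $r$ be an even integer such that $r/2$ is even. Then every connected $r$-regular finite simple graph $G$ with an even number of vertices has a spanning subgraph $F$ such that $d_F(v)\in\{r/2-1,\ r/2+1\}$ for every vertex $v$ of $G$.
   Context: $d_F(v)$ denotes the degree of $v$ in the subgraph $F$. *)

(* Defs.v *)
From mathcomp Require Import all_boot.

Set Implicit Arguments.
Unset Strict Implicit.
Unset Printing Implicit Defensive.

(* The vertex set is the whole finite type V. *)
Record sgraph (V : finType) := SGraph {
  adj :> rel V;
  adj_sym : symmetric adj;
  adj_irrefl : irreflexive adj
}.

Definition degree (V : finType) (G : sgraph V) (v : V) : nat :=
  #|[set w | adj G v w]|.

Definition regular (V : finType) (r : nat) (G : sgraph V) : Prop :=
  forall v : V, degree G v = r.

(* The graph on the empty vertex set counts as connected. *)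
Definition connected (V : finType) (G : sgraph V) : Prop :=
  forall u v : V, connect (adj G) u v.

(* Both graphs live on the same vertex type, so a subgraph is spanning as soon
   as its edges are edges of G. *)
Definition spanning_subgraph (V : finType) (F G : sgraph V) : Prop :=
  subrel (adj F) (adj G).

(* Main.v *)
(**
Walk along an Eulerian circuit of [G], switching between two colours at every
passage through a vertex, except at the last passage through each vertex, where
the colour is kept. Each vertex is passed [r/2] times, so a vertex meets
[r/2 - 1] edges of the first colour at its switching passages, and 0 or 2 at
the remaining one. The colouring closes up since the number of switches,
[#|V| * (r/2 - 1)], is even.
*)
Require Import Defs.
From mathcomp Require Import all_boot.
From mathcomp Require Import zify.

Set Implicit Arguments.
Unset Strict Implicit.
Unset Printing Implicit Defensive.

(** * Oriented edge sequences, their degree counts and the alternating colouring *)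

Section Darts.

Variable V : finType.
Implicit Types (d e : V * V) (s : seq (V * V)) (v w : V) (c : bool).

Definition linked : rel (V * V) := fun d e => d.2 == e.1.

Definition flip d := (d.2, d.1).

Definition bidart s := s ++ map flip s.

Definition num_out v s := count (fun d => d.1 == v) s.
Definition num_in v s := count (fun d => d.2 == v) s.

Lemma mem_bidart v w s : ((v, w) \in bidart s) = ((v, w) \in s) || ((w, v) \in s).
Proof.
rewrite mem_cat; congr (_ || _); apply/mapP/idP => [[[a b] h [-> ->]] //|h].
by exists (w, v).
Qed.

Lemma num_out_bidart v s : num_out v (bidart s) = num_out v s + num_in v s.
Proof. by rewrite /num_out count_cat count_map. Qed.

Lemma num_out_uniq v s : uniq s -> num_out v s = #|[set w | (v, w) \in s]|.
Proof.
move=> Us; rewrite /num_out -size_filter -(size_map snd).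
have /card_uniqP <- : uniq [seq d.2 | d <- s & d.1 == v].
  rewrite map_inj_in_uniq ?filter_uniq // => -[a b] [a' b'].
  by rewrite !mem_filter /= => /andP[/eqP -> _] /andP[/eqP -> _] ->.
apply: eq_card => w; rewrite inE; apply/mapP/idP => [[[a b]]|h].
  by rewrite mem_filter /= => /andP[/eqP -> h] ->.
by exists (v, w); rewrite // mem_filter eqxx.
Qed.

Lemma num_in_gt0 v s : (0 < num_in v s) = (v \in map snd s).
Proof.
rewrite -has_count; apply/hasP/mapP => [[d ds /eqP <-]|[d ds ->]]; by exists d.
Qed.

Lemma num_out_gt0 v s : (0 < num_out v s) = (v \in map fst s).
Proof.
rewrite -has_count; apply/hasP/mapP => [[d ds /eqP <-]|[d ds ->]]; by exists d.
Qed.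

Lemma sum_num_in s : \sum_v num_in v s = size s.
Proof.
elim: s => [|d s IH]; first by rewrite big1.
rewrite (eq_bigr (fun v => (d.2 == v) + num_in v s)) // big_split /= IH.
by rewrite (bigD1 d.2) //= eqxx big1 // => v /negPf; rewrite eq_sym => ->.
Qed.

(** Each head is the next tail, so tails and heads balance except at the two ends of the walk; [e]
    only supplies the starting vertex. *)
Lemma num_out_path v e s : path linked e s ->
  num_out v s + ((last e s).2 == v) = num_in v s + (e.2 == v).
Proof.
elim: s e => [|d s IH] e //= /andP[/eqP ed /IH].
by rewrite /num_out /num_in /= ed; lia.
Qed.

Lemma num_out_cycle s v : cycle linked s -> num_out v s = num_in v s.
Proof.
case: s => [//|d s]; rewrite (cycle_path d) => /(num_out_path v) /=.
exact: addIn.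
Qed.

(* [paint c s] is the first colour class when the first edge has colour [c];
   [end_colour c s] is the colour with which the walk would continue after [s]:
   the non-switching passages, being last ones, are counted by [undup]. *)
Definition end_colour c s :=
  c (+) odd (size s) (+) odd (size (undup (map snd s))).

Fixpoint paint c s :=
  if s is d :: s' then
    let p := paint (c (+) (d.2 \in map snd s')) s' in
    if c then d :: p else p
  else [::].

Lemma paint_subseq c s : subseq (paint c s) s.
Proof.
elim: s c => [|d s IH] c //=.
case: c; first by rewrite eqxx.
exact: subseq_trans (IH _) (subseq_cons _ _).
Qed.

(** Group the coloured edge ends at [v] by passages: a switching passage contributes 1, the last one
    contributes [k.*2]. The tail of the first dart belongs to no passage in [s], and the final
    passage leaves by a virtual edge of colour [end_colour c s]; hence the two boundary terms. *)
Lemma num_paint v c e s : path linked e s ->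
  exists k : bool, k <= (v \in map snd s) /\
    num_out v (paint c s) + num_in v (paint c s)
      + (end_colour c s && ((last e s).2 == v)) + (v \in map snd s)
    = num_in v s + (c && (e.2 == v)) + k.*2.
Proof.
elim: s c e => [|d s IH] c e /=.
  by exists false; rewrite /end_colour /=; split=> //; case: c; rewrite /= ?add0n ?addn0.
move=> /andP[/eqP ed pds].
have [k [kle]] := IH (c (+) (d.2 \in map snd s)) d pds.
have -> : end_colour (c (+) (d.2 \in map snd s)) s = end_colour c (d :: s).
  rewrite /end_colour /=; case: ifP => _ /=;
  by case: c; case: (odd (size s)); case: (odd _).
rewrite in_cons (eq_sym v) ed.
move: (end_colour _ _ && _) => b.
have [dv|nv] := eqVneq d.2 v.
- rewrite -dv in kle *; rewrite /=; case ins: (d.2 \in map snd s) kle => /= kle Hk.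
  + exists k; split; first by case: k {Hk kle}.
    by move: Hk; case: c; rewrite /num_out /num_in /= ?eqxx; lia.
  (* This is the last passage through [v], so both its edges have colour [c]. *)
  + exists c; split; first by case: c {Hk}.
    by move: Hk kle; case: c; case: k; rewrite /num_out /num_in /= ?eqxx; lia.
- move=> Hk; exists k; split=> //.
  by move: Hk; case: c; rewrite /num_out /num_in /= ?(negPf nv) !andbF; lia.
Qed.

End Darts.

(** * Existence of an Eulerian circuit *)

Section Trails.

Variables (V : finType) (G : sgraph V).
Implicit Types (d e : V * V) (s : seq (V * V)) (v w : V).

(** Uniqueness of [bidart s], rather than of [s], also forbids reusing an edge in the opposite
    direction. *)
Definition trail s :=
  [&& sorted (@linked V) s, all (fun d => G d.1 d.2) s & uniq (bidart s)].

Lemma trail_subrel s v w : trail s -> (v, w) \in bidart s -> G v w.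
Proof.
case/and3P=> _ /allP sG _; rewrite mem_bidart => /orP[] /sG //=.
by rewrite adj_sym.
Qed.

Lemma bidart_degree s v : trail s ->
  num_out v s + num_in v s <= degree G v
    ?= iff [forall w, G v w ==> ((v, w) \in bidart s)].
Proof.
move=> ts; have /and3P[_ _ Us] := ts.
rewrite -num_out_bidart num_out_uniq //.
have sub : [set w | (v, w) \in bidart s] \subset [set w | G v w].
  by apply/subsetP=> w; rewrite !inE; exact: trail_subrel.
split; first exact: subset_leq_card.
rewrite /degree (subset_leqif_cards sub).
apply/eqP/forallP => [/setP eqS w|h].
  by have := eqS w; rewrite !inE => ->; apply/implyP.
apply/eqP; rewrite eqEsubset sub; apply/subsetP=> w; rewrite !inE.
exact/implyP.
Qed.

Lemma trail_rcons e s w : trail (rcons s e) -> G e.2 w ->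
  (e.2, w) \notin bidart (rcons s e) -> trail (rcons (rcons s e) (e.2, w)).
Proof.
move: e => [u v] /= /and3P[ss sG Us] Gvw vwN; apply/and3P; split.
- case: s ss {sG Us vwN} => [|d s] /=; first by rewrite /linked /= eqxx.
  by rewrite !rcons_path last_rcons => ->; rewrite /linked /= eqxx.
- by rewrite all_rcons /= Gvw.
- rewrite (@perm_uniq _ _ ((v, w) :: (w, v) :: bidart (rcons s (u, v)))).
    rewrite /= Us inE negb_or vwN !andbT mem_bidart orbC -mem_bidart vwN andbT.
    by apply: contraTneq Gvw => -[-> _]; rewrite adj_irrefl.
  rewrite /bidart map_rcons; apply/permP => P.
  by rewrite -!cats1 /= !count_cat /= -/(flip (v, w)); lia.
Qed.

Hypotheses (G_even : forall v, ~~ odd (degree G v)) (G_connected : connected G).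

Lemma trail_extend s : trail s -> s != [::] ->
  (cycle (@linked V) s /\ forall v w, G v w -> (v, w) \in bidart s)
  \/ exists2 s', trail s' & size s' = (size s).+1.
Proof.
case: s => // d p ts _; set s := d :: p.
have [cs|ncs] := boolP (cycle (@linked V) s); last first.
  right; set e := last d p.
  have/and3P[sp _ _] := ts.
  have Nodd : odd (num_out e.2 s + num_in e.2 s).
    (* The fictitious dart [(d.1, d.1)] makes the walk start at [d.1], so that the tail of [d] is
       counted. *)
    have := @num_out_path _ e.2 (d.1, d.1) s; rewrite /= /linked /= eqxx => /(_ sp).
    rewrite -/e eqxx; have -> : (d.1 == e.2) = false; last by lia.
    apply: contraNF ncs => /eqP h.
    by rewrite (cycle_path d) /= -/e {1}/linked h eqxx.
  have /forallPn[w] : ~~ [forall w, G e.2 w ==> ((e.2, w) \in bidart s)].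
    rewrite -(bidart_degree e.2 ts).
    by apply: contraTneq Nodd => ->; exact: G_even.
  rewrite negb_imply => /andP[Gw wN].
  exists (rcons s (e.2, w)); last by rewrite size_rcons.
  by move: ts Gw wN; rewrite /s lastI; exact: trail_rcons.
have ds : d.2 \in map snd s by rewrite mem_head.
rewrite -/s in ts; clearbody s.
have [|nall] := boolP [forall u in map snd s,
    [forall w, G u w ==> ((u, w) \in bidart s)]].
  move=> /forall_inP all_used; left; split=> //.
  have closedA : closed G [pred u | u \in map snd s].
    apply: intro_closed; first by apply: sym_connect_sym; exact: adj_sym.
    move=> u w Guw /= us; have /forallP/(_ w)/implyP/(_ Guw) := all_used u us.
    rewrite mem_bidart => /orP[] uw; rewrite inE; first by apply/mapP; exists (u, w).
    (* On a closed trail every tail is also a head. *)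
    by rewrite -num_in_gt0 -num_out_cycle // num_out_gt0; apply/mapP; exists (w, u).
  move=> v w Gvw.
  have vs : v \in map snd s.
    by have := closed_connect closedA (G_connected d.2 v); rewrite !inE ds.
  by have /forallP/(_ w)/implyP/(_ Gvw) := all_used v vs.
right; move: nall => /forallPn[u]; rewrite negb_imply => /andP[/mapP[e es ->]].
move=> /forallPn[w]; rewrite negb_imply => /andP[Gw wN].
(* Rotating [e] to the front and then moving it to the back yields a trail that ends at [e.2]. *)
have [i p' rot_s] := rot_to es.
exists (rcons (rcons p' e) (e.2, w)); last first.
  by rewrite -(size_rot i s) rot_s !size_rcons.
have rot_s' : perm_eq (rcons p' e) s by rewrite perm_rcons -rot_s perm_rot.
have/and3P[_ sG Us] := ts.
have bi_s : perm_eq (bidart (rcons p' e)) (bidart s) by rewrite perm_cat ?perm_map.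
apply: trail_rcons => //; last by rewrite (perm_mem bi_s).
apply/and3P; split; last 2 first.
- by rewrite (perm_all _ rot_s').
- by rewrite (perm_uniq bi_s).
by move: cs; rewrite -(rot_cycle i) rot_s /= => /path_sorted.
Qed.

Lemma euler_circuit v w : G v w ->
  exists s, [/\ trail s, cycle (@linked V) s & forall a b, G a b -> (a, b) \in bidart s].
Proof.
move=> Gvw.
have Nvw : v != w by apply: contraTneq Gvw => ->; rewrite adj_irrefl.
have t1 : trail [:: (v, w)].
  by apply/and3P; split; rewrite //= ?Gvw // inE xpair_eqE negb_and Nvw.
have : [:: (v, w)] != [::] by [].
(* Extension must stop, since [bidart s] has at most [#|{: V * V}|] entries. *)
have [n] := ubnP (#|{: V * V}| - size [:: (v, w)]).
elim: n [:: (v, w)] t1 => // n IH s ts len s0.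
have [[cs all_s]|[s' ts' sz]] := trail_extend ts s0; first by exists s.
apply: (IH s') => //; last by rewrite -size_eq0 sz.
have /and3P[_ _ /card_uniqP Us] := ts'.
have : size (bidart s') <= #|{: V * V}| by rewrite -Us max_card.
by rewrite size_cat size_map sz; lia.
Qed.

End Trails.

(** * Subgraphs formed by some of the edges of a trail *)

Section DartGraph.

Variables (V : finType) (G : sgraph V) (s : seq (V * V)).
Hypothesis s_trail : trail G s.
Variable t : seq (V * V).
Hypothesis t_sub : subseq t s.

Definition dart_adj : rel V := fun v w => (v, w) \in bidart t.

Lemma dart_adj_subrel : subrel dart_adj G.
Proof.
move=> v w h; apply: (trail_subrel s_trail); move: h.
by rewrite /dart_adj !mem_bidart => /orP[] /(mem_subseq t_sub) ->; rewrite ?orbT.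
Qed.

Lemma dart_adj_sym : symmetric dart_adj.
Proof. by move=> v w; rewrite /dart_adj !mem_bidart orbC. Qed.

Lemma dart_adj_irrefl : irreflexive dart_adj.
Proof. by move=> v; apply/negP => /dart_adj_subrel; rewrite adj_irrefl. Qed.

Definition dart_graph := SGraph dart_adj_sym dart_adj_irrefl.

Lemma dart_graph_degree v : degree dart_graph v = num_out v t + num_in v t.
Proof.
rewrite -num_out_bidart num_out_uniq //.
have /and3P[_ _] := s_trail; apply: subseq_uniq.
by rewrite cat_subseq ?map_subseq.
Qed.

End DartGraph.

Theorem theorem2p2 (r : nat) (r_even : ~~ odd r) (r2_even : ~~ odd r./2)
    (V : finType) (G : sgraph V) (G_connected : connected G)
    (G_regular : regular r G) (V_even : ~~ odd #|V|) :
  exists F : sgraph V,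
    spanning_subgraph F G /\
    (forall v : V, degree F v = r./2 - 1 \/ degree F v = r./2 + 1).
Proof.
(* If there is no edge, any vertex forces [r = 0]; the truncated [r./2 - 1] is then 0 and [G] itself
   serves. *)
have [[v w] /= Gvw|G0] := pickP (fun d : V * V => G d.1 d.2); last first.
  have deg0 v : degree G v = 0.
    by apply: eq_card0 => w; rewrite inE; exact: (G0 (v, w)).
  exists G; split=> // v; left.
  by rewrite deg0 -(G_regular v) deg0.
have G_even u : ~~ odd (degree G u) by rewrite G_regular.
have [s [ts cs all_s]] := euler_circuit G_even G_connected Gvw.
have in_r2 u : num_in u s = r./2.
  have : num_out u s + num_in u s = r.
    rewrite -(G_regular u); apply/eqP; rewrite (bidart_degree u ts).
    by apply/forallP=> x; apply/implyP; exact: all_s.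
  by rewrite num_out_cycle //; lia.
have r2_gt0 : 0 < r./2.
  have : 0 < r by rewrite -(G_regular v); apply/card_gt0P; exists w; rewrite inE.
  by lia.
have passed u : u \in map snd s by rewrite -num_in_gt0 in_r2.
(* Each vertex has exactly one last passage, so [undup] counts [#|V|]; this and the total
   [#|V| * r./2] of passages are both even. *)
have closes c : end_colour c s = c.
  have -> : end_colour c s = c (+) odd (\sum_(u : V) r./2) (+) odd #|V|.
    rewrite /end_colour -(sum_num_in s); congr (_ (+) odd _ (+) odd _).
      exact: eq_bigr.
    rewrite -(card_uniqP (undup_uniq _)); apply: eq_card => u.
    by rewrite mem_undup passed.
  by rewrite sum_nat_const oddM (negPf V_even) !addbF.
have t_sub := paint_subseq true s.
exists (dart_graph ts t_sub); split; first exact: (dart_adj_subrel ts t_sub).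
move=> u; rewrite dart_graph_degree.
(* With the last dart of the circuit as predecessor of the first, the boundary terms of [num_paint]
   cancel, leaving degree [r./2 - 1 + k.*2]. *)
move: cs; rewrite (cycle_path (v, w)); set e := last _ s => es.
have [k [_]] := num_paint u true es.
have -> : last e s = e.
  by rewrite /e; case: (s) (passed v).
rewrite closes passed in_r2 /=; case: k => /= ?; [right|left]; lia.
Qed.
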